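(* Let $P\in\mathbf{Q}[T,X]$ be an irreducible polynomial of degree at least $1$ in $X$, with Galois group $G$ over $\mathbf{Q}(T)$. Let $\Delta(T)$ and $\ell(T)$ be the discriminant and leading coefficient of $P$ (as a polynomial in $X$), respectively. Let $M_1,\ldots,M_r$ be representatives of all the conjugacy classes of maximal subgroups of $G$. For $i=1,\ldots,r$, let $F_i$ be the fixed field of $M_i$ and let $f_i(T,X)$ be a monic irreducible polynomial in $\mathbf{Q}[T][X]$ such that $F_i/\mathbf{Q}(T)$ is generated by a root of $f_i(T,X)$. Suppose that $t\in\mathbf{Q}$ satisfies $$\Delta(t)\cdot\ell(t)\cdot\prod_{i=1}^r\operatorname{disc} f_i(t,X)\neq 0.$$ Then $t\in\mathcal{E}(P)$ if and only if there is an index $i$ such that $f_i(t,X)$ has a root in $\mathbf{Q}$.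
   Context: $P$ is regarded as an element of $\mathbf{Q}(T)[X]$, and $G=\operatorname{Gal}(N/\mathbf{Q}(T))$, where $N$ is a splitting field of $P$ over $\mathbf{Q}(T)$; the fixed fields $F_i$ are subfields of $N$. For $t\in\mathbf{Q}$, $P_t=P(t,X)\in\mathbf{Q}[X]$ is the specialized polynomial and $G_t$ is its Galois group over $\mathbf{Q}$ (the Galois group of a splitting field of $P_t$). The exceptional set $\mathcal{E}(P)$ is the set of all $t\in\mathbf{Q}$ such that either $P_t$ is reducible in $\mathbf{Q}[X]$ or $G_t$ is not isomorphic to $G$. Discriminants are taken with respect to $X$. *)

(* Defs.v *)
From HB Require Import structures.
From mathcomp Require Import all_boot all_order all_algebra all_fingroup.
From mathcomp Require Import all_solvable all_field.
From mathcomp Require Import zify.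
Set Implicit Arguments.
Unset Strict Implicit.
Unset Printing Implicit Defensive.
Import GRing.Theory Num.Theory.
Local Open Scope ring_scope.

(* Q[T, X] is {poly {poly rat}}: X is the outer variable, T the inner one. *)
Notation ratXT := {poly {poly rat}}.

(* The library's irreducible_poly is meant for coefficients in a field: over
   Q[T] it would allow any content, so irreducibility in Q[T, X] is stated in
   the ring-theoretic sense.  Taking a = b = 0 shows that 0 is excluded. *)
Definition irreducible_elt (R : unitRingType) (p : R) : Prop :=
  p \isn't a GRing.unit /\
  forall a b : R, p = a * b -> a \is a GRing.unit \/ b \is a GRing.unit.

Notation QT := {fraction {poly rat}}.

Definition over_QT (P : ratXT) : {poly QT} := map_poly (@tofrac {poly rat}) P.

(* P(t, X) *)
Definition specialize (t : rat) (P : ratXT) : {poly rat} :=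
  map_poly (horner_eval t) P.

(* disc p = (-1)^(n(n-1)/2) Res(p, p') / lead_coef p, where n = deg p >= 1. *)
Definition disc_num (R : nzRingType) (p : {poly R}) : R :=
  (-1) ^+ 'C((size p).-1, 2) * resultant p p^`().

Definition disc (K : fieldType) (p : {poly K}) : K := disc_num p / lead_coef p.

(* Here the quotient is a Euclidean quotient in Q[T]; it is exact, see
   disc_XE. *)
Definition disc_X (P : ratXT) : {poly rat} := disc_num P %/ lead_coef P.

Definition is_splitting_field (K : fieldType) (p : {poly K})
    (L : splittingFieldType K) : Prop :=
  splittingFieldFor 1%VS (map_poly (in_alg L) p) {:L}%VS.

(* The group of K-automorphisms of L. *)
Definition Galois_group (K : fieldType) (L : splittingFieldType K) :
  {group gal_of {:L}} := 'Gal({:L} / 1%VS)%G.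

Definition generated_by_root (N : splittingFieldType QT) (f : ratXT)
    (F : {vspace N}) : Prop :=
  exists2 a : N, root (map_poly (in_alg N) (over_QT f)) a & <<1%VS; a>>%VS = F.

Definition maximal_class_reps (gT : finGroupType) (G : {group gT}) (r : nat)
    (M : 'I_r -> {group gT}) : Prop :=
  (forall i, maximal (M i) G) /\
  (forall H : {group gT}, maximal H G ->
     exists! i, exists2 x, x \in G & H :=: (M i :^ x)%g).

(* The exceptional set of P, N being a splitting field of P over Q(T). *)
Definition exceptional (P : ratXT) (N : splittingFieldType QT) (t : rat) :
    Prop :=
  ~ irreducible_poly (specialize t P) \/
  exists2 L : splittingFieldType rat,
    is_splitting_field (specialize t P) L &
    ~ (Galois_group L \isog Galois_group N).

Lemma lead_coef_dvd_disc_num (P : ratXT) :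
  (1 < size P)%N -> lead_coef P %| disc_num P.
Proof.
move=> sP; apply: dvdp_mull; rewrite /resultant.
set dS := ((size P^`()).-1 + (size P).-1)%N.
have dS_gt0 : (0 < dS)%N by rewrite /dS addn_gt0 orbC; case: (size P) sP => [|[]].
have j_lt : (dS.-1 < dS)%N by rewrite prednK.
have sP' : (size P^`()).-1 = (size P).-2.
  suff -> : size P^`() = (size P).-1 by [].
  apply/eqP; rewrite eqn_leq; apply/andP; split.
    have /lt_size_deriv : P != 0 by rewrite -size_poly_gt0 ltnW.
    by case: (size P) sP.
  have nz : P^`()`_(size P).-2 != 0.
    have e : (size P).-2.+1 = (size P).-1 by case: (size P) sP => [|[]].
    rewrite coef_deriv e -mulr_natr mulf_neq0 //.
      by rewrite -/(lead_coef P) lead_coef_eq0 -size_poly_gt0 ltnW.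
    rewrite -polyC_natr polyC_eq0 pnatr_eq0.
    by case: (size P) sP => [|[]].
  have : ((size P).-2 < size P^`())%N.
    by rewrite ltnNge; apply/negP=> /(nth_default 0) h; rewrite h eqxx in nz.
  by case: (size P) sP => [|[]].
have coefP m : ((size P).-1 <= m)%N -> lead_coef P %| P`_m.
  rewrite leq_eqVlt => /orP[/eqP <-|lt]; first exact: dvdpp.
  by rewrite nth_default ?dvdp0 //; case: (size P) sP lt.
rewrite (expand_det_col _ (Ordinal j_lt)).
apply: (big_ind (fun x => lead_coef P %| x)); [exact: dvdp0 | |].
  by move=> x y; exact: dvdp_add.
move=> i _; apply: dvdp_mulr; rewrite Sylvester_mxE /=.
case: (split i) => k; case: (k <= _)%N; rewrite ?mulr1n ?mulr0n ?dvdp0 //.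
  apply: coefP; move: (nat_of_ord k) (ltn_ord k) => m; rewrite /dS.
  by lia.
rewrite coef_deriv -mulr_natr; apply: dvdp_mulr; apply: coefP.
by move: (nat_of_ord k) (ltn_ord k) => m; rewrite /dS sP'; lia.
Qed.

Lemma disc_XE (P : ratXT) :
  (1 < size P)%N -> disc_X P * lead_coef P = disc_num P.
Proof. by move=> sP; rewrite /disc_X divpK // lead_coef_dvd_disc_num. Qed.

(* Main.v *)
Require Import Defs.
From HB Require Import structures.
From mathcomp Require Import all_boot all_order all_algebra all_fingroup.
From mathcomp Require Import all_solvable all_field.
From mathcomp Require Import boolp.
From mathcomp Require Import ring zify.
Set Implicit Arguments.
Unset Strict Implicit.
Unset Printing Implicit Defensive.
Import GRing.Theory.
Local Open Scope ring_scope.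

(** Let L be a splitting field of P_t over Q.  The proof compares N with L
through a place: a ring morphism from a subring of N to L that extends
g |-> g(t) on Q[T], can be divided wherever its value is nonzero, and is
defined at all the roots of P in N.  Such a place exists because the roots are
integral over the local ring of Q[T] at t (the leading coefficient does not
vanish at t), and a place extends to an integral element as soon as the value
of its monic equation splits in L ([place_extension]).  As P_t is separable,
the place maps the roots of P bijectively to those of P_t.

Since distinct elements of G move the roots differently, even after taking
values, some integral a in N has a value different from those of its other
conjugates.  Interpolating at the conjugates of a writes every x in N, times a
fixed element of nonzero value, as h(a), where h has coefficients in Q(T), and
in Q[T] localized at t as soon as x is integral over Q[T].  Two consequences:
the place is defined at every integral element ([integral_regular]), and every
automorphism u of L is induced by some s in G, in the sense that
u (value x) = value (s x) for all integral x ([gal_lift]).  As s is determined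
by u, this embeds Gal(L/Q) in G with some image D, the decomposition group
([decomposition_group]); so Gal(L/Q) is isomorphic to G exactly when D = G.

If D = G, then P_t is irreducible, because G permutes the roots of P
transitively ([isog_irreducible]).  Hence t is exceptional exactly when
D <> G, that is, when D lies in a conjugate of some M_i.  If it does, D fixes
a root b of f_i, so the value of b is fixed by Gal(L/Q), hence rational, and it
is a root of f_i(t, X) ([sub_conj_root]).  Conversely, a rational root of
f_i(t, X) is the value of some root z of f_i in N.  Every s in D sends z to a
root with the same value, so s z = z because f_i(t, X) is separable; if D were
G, then z would lie in Q(T), and M_i would be G ([isog_root_fixedField]).

Irreducibility in Q[T, X] is used over Q(T), through Gauss's lemma
([irreducible_over_QT]). *)

(** * Gauss's lemma *)

Lemma tofrac_inj (R : idomainType) : injective (@tofrac R).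
Proof. by move=> a b /eqP; rewrite tofrac_eq => /eqP. Qed.

Lemma fraction_quotient (R : idomainType) (c : {fraction R}) :
  exists a b : R, b != 0 /\ c * tofrac b = tofrac a.
Proof.
elim/quotW: c => x; exists \n_x, \d_x; split; first exact: denom_ratioP.
rewrite -[_ * _]/(FracField.mul _ _); apply/eqP.
rewrite !piE FracField.equivfE /FracField.mulf.
by rewrite !numden_Ratio ?(oner_eq0, mulf_neq0, denom_ratioP) // !mulr1 mulrC.
Qed.

Lemma clear_denominators (R : idomainType) (q : {poly {fraction R}}) :
  exists c u, c != 0 /\ map_poly (@tofrac R) u = tofrac c *: q.
Proof.
elim/poly_ind: q => [|q x [c [u [c0 Du]]]].
  by exists 1, 0; rewrite oner_neq0 rmorph0 scaler0.
have [a [b [b0 Da]]] := fraction_quotient x.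
exists (c * b), (b *: u * 'X + (c * a)%:P); rewrite mulf_neq0 //; split=> //.
rewrite rmorphD rmorphM /= map_polyZ map_polyX map_polyC /= Du !tofracM -Da.
rewrite scalerDr scalerAl !scalerA [tofrac b * _]mulrC; congr (_ + _).
by rewrite -mul_polyC -polyCM mulrAC mulrA.
Qed.

Lemma content_factor (R : fieldType) (p : {poly R}) (u : {poly {poly R}}) :
  (forall i, p %| u`_i) -> exists u1, u = p *: u1.
Proof.
move=> dvd_u; exists (\poly_(i < size u) (u`_i %/ p)).
apply/polyP=> i; rewrite coefZ coef_poly.
by case: ltnP => lt_i; [rewrite mulrC divpK | rewrite nth_default ?mulr0].
Qed.

(** A nonconstant c can be divided out of the factorization one prime at a time.
    Setting T to a complex root z of c maps u * v to 0 in the domain algC[X], so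
    one of the factors vanishes there; all its coefficients are then multiples
    of the minimal polynomial p of z, and so is c. *)
Lemma scaled_factorization (P u v : {poly {poly rat}}) c :
    c != 0 -> c *: P = u * v ->
  exists u' v', [/\ P = u' * v', size u' = size u & size v' = size v].
Proof.
have [n le_n] := ubnP (size c).
elim: n => // n IHn in c u v le_n *; move=> c0 DP.
have [sc|sc] := leqP (size c) 1.
  move: c0 DP; rewrite (size1_polyC sc) polyC_eq0; set e := c`_0 => e0 DP.
  exists (e^-1%:P *: u), v.
  rewrite size_scale ?polyC_eq0 ?invr_eq0 //; split=> //.
  by rewrite -scalerAl -DP scalerA -polyCM mulVf // scale1r.
have /closed_rootP[z cz] : size (map_poly ratr c : {poly algC}) != 1.
  by rewrite size_map_poly neq_ltn sc orbT.
have [p [_ mon_p pP]] := minCpolyP z.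
pose e (a : {poly rat}) : algC := (map_poly ratr a).[z].
have eP a : (e a == 0) = (p %| a) by rewrite -pP rootE.
have sp : (1 < size p)%N.
  have : size p != 1%N.
    apply/size_poly1P => -[b b0 Db]; have := dvdpp p.
    rewrite -eP /e Db map_polyC hornerC /= fmorph_eq0.
    by rewrite (negPf b0).
  by have := size_poly_gt0 p; rewrite monic_neq0 //; case: (size p) => [|[]].
have p0 : p != 0 by rewrite -size_poly_gt0 ltnW.
have [c1 Dc] : exists c1, c = c1 * p by apply/dvdpP; rewrite -pP.
have c10 : c1 != 0 by apply: contraNneq c0 => c10; rewrite Dc c10 mul0r.
have lt_c1 : (size c1 < n)%N.
  apply: leq_trans (le_n : (_ <= n)%N).
  rewrite Dc size_mul // -subn1 -addnBA ?(ltnW sp) //.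
  by rewrite -[ltnLHS]addn0 ltn_add2l subn_gt0.
have content w : map_poly e w = 0 -> exists w1, w = p *: w1.
  move=> w0; apply: content_factor => i; rewrite -eP.
  have := congr1 (coefp i) w0; rewrite /= coef0.
  by rewrite coef_map_id0 ?/e ?rmorph0 ?horner0 // => ->.
have cancel w w1 : c *: P = w * w1 * p%:P -> c1 *: P = w * w1.
  move=> e1; apply: (mulIf (_ : p%:P != 0)); first by rewrite polyC_eq0.
  by rewrite -e1 Dc -scalerAl mulrC mul_polyC scalerA.
have : map_poly e u * map_poly e v = 0.
  have /(congr1 (map_poly (horner_eval z \o map_poly ratr))) := DP.
  rewrite rmorphM /= => <-; rewrite map_polyZ /= /horner_eval.
  by rewrite (rootP cz) scale0r.
move/eqP; rewrite mulf_eq0 => /orP[] /eqP/content[w Dw].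
- have [|u' [v' [-> su sv]]] := IHn c1 w v lt_c1 c10.
    by apply: cancel; rewrite DP Dw -scalerAl -mul_polyC mulrC.
  by exists u', v'; rewrite su sv Dw size_scale.
- have [|u' [v' [-> su sv]]] := IHn c1 u w lt_c1 c10.
    by apply: cancel; rewrite DP Dw -scalerAr -mul_polyC mulrC.
  by exists u', v'; rewrite su sv Dw size_scale.
Qed.

(** Clearing denominators turns a factorization over Q(T) into one of a multiple
    of P in Q[T][X], whose scalar is removed without changing the degrees. *)
Lemma irreducible_over_QT (P : ratXT) : irreducible_elt P -> (1 < size P)%N ->
  irreducible_poly (over_QT P).
Proof.
move=> [_ irrP] sP.
have size_QT (u : ratXT) : size (over_QT u) = size u.
  by rewrite size_map_inj_poly ?rmorph0 //; apply: tofrac_inj.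
split=> [|q sq /dvdpP[w Dw]]; first by rewrite size_QT.
have [c [u [c0 Du]]] := clear_denominators w.
have [d [v [d0 Dv]]] := clear_denominators q.
have DP : (c * d) *: P = u * v.
  apply: (map_inj_poly (f := @tofrac _)); rewrite ?rmorph0 //.
    exact: tofrac_inj.
  rewrite rmorphM /= Du Dv map_polyZ /= -/(over_QT P) Dw.
  by rewrite rmorphM -scalerAl -scalerAr scalerA.
have [u' [v' [DP' su sv]]] := scaled_factorization (mulf_neq0 c0 d0) DP.
have sw : size w = size u'.
  by rewrite su -(size_QT u) /over_QT Du size_scale ?tofrac_eq0.
have sq' : size q = size v'.
  by rewrite sv -(size_QT v) /over_QT Dv size_scale ?tofrac_eq0.
have [|] := irrP _ _ DP'; rewrite poly_unitE => /andP[/eqP s1 _]; last first.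
  by rewrite sq' s1 in sq.
rewrite Dw eqp_sym; move: sw; rewrite s1 => /eqP/size_poly1P[b b0 ->].
by rewrite mul_polyC eqp_scale.
Qed.

(** * Separability, splitting fields, Galois conjugates *)

(** Realized inside the algebraic numbers, by the field that the complex roots
    of p generate. *)
Lemma exists_splitting_field (p : {poly rat}) : p != 0 ->
  exists L : splittingFieldType rat, is_splitting_field p L.
Proof.
move=> p0; pose pC : {poly algC} := map_poly ratr p.
have [r Dp] := closed_field_poly_normal pC.
have [Q [QC [s1 Ds1 gen_s1]]] := num_field_exists r.
have split_p : splittingFieldFor 1%VS (map_poly (in_alg Q) p) {:Q}%VS.
  exists s1 => //; rewrite -(eqp_map QC) -map_poly_comp.
  rewrite (@eq_map_poly _ _ _ ratr) => [|c]; last first.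
    by rewrite /= alg_num_field fmorph_rat.
  rewrite -/pC Dp rmorph_prod /= -Ds1 big_map.
  under [X in _ %= X]eq_bigr do rewrite rmorphB /= map_polyX map_polyC.
  by rewrite eqp_scale // lead_coef_eq0 map_poly_eq0.
have ax : SplittingField.axiom Q.
  exists (map_poly (in_alg Q) p) => //.
  by apply/polyOverP => i; rewrite coef_map /=; apply/vlineP; exists p`_i.
pose QM := FieldExt_isSplittingField.Build rat Q ax.
pose L : splittingFieldType rat := HB.pack Q QM.
by exists L.
Qed.

Lemma lead_coef_deriv_rat (P : ratXT) : (1 < size P)%N ->
  lead_coef P^`() = lead_coef P *+ (size P).-1.
Proof.
move=> sP; have P0 : P != 0 by rewrite -size_poly_gt0 ltnW.
have s2 : (size P).-2.+1 = (size P).-1 by case: (size P) sP => [|[]].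
have coefP' : P^`()`_(size P).-2 = lead_coef P *+ (size P).-1.
  by rewrite coef_deriv s2.
have nz : lead_coef P *+ (size P).-1 != 0.
  rewrite -mulr_natr mulf_neq0 ?lead_coef_eq0 // -polyC_natr polyC_eq0.
  by rewrite Num.Theory.pnatr_eq0 -s2.
have lt_s : ((size P).-2 < size P^`())%N.
  by rewrite ltnNge; apply: contra nz => /(nth_default 0) e; rewrite -coefP' e.
suff sP' : size P^`() = (size P).-1 by rewrite /lead_coef sP'.
apply/eqP; rewrite eqn_leq -{2}s2 lt_s andbT -ltnS (ltn_predK sP).
exact: lt_size_deriv.
Qed.

Lemma separable_of_resultant (K : fieldType) (p : {poly K}) : p != 0 ->
  resultant p p^`() != 0 -> separable_poly p.
Proof.
move=> p0; rewrite resultant_eq0 -leqNgt separable_poly.unlock /coprimep => le1.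
by rewrite eqn_leq le1 size_poly_gt0 gcdp_eq0 negb_and p0.
Qed.

Lemma disc_separable (K : fieldType) (p : {poly K}) :
  disc p != 0 -> separable_poly p.
Proof.
rewrite /disc /disc_num !mulf_eq0 invr_eq0 !negb_or lead_coef_eq0.
by case/andP=> /andP[_ r0] p0; apply: separable_of_resultant.
Qed.

(** Up to sign, disc_X P times the leading coefficient is the resultant of P and
    its derivative, and this resultant commutes with T := t because neither
    leading coefficient vanishes at t. *)
Lemma specialize_separable (P : ratXT) (t : rat) : (1 < size P)%N ->
  (disc_X P).[t] * (lead_coef P).[t] != 0 -> separable_poly (specialize t P).
Proof.
move=> sP; rewrite -hornerM disc_XE // /disc_num => dt.
have lt0 : (lead_coef P).[t] != 0.
  apply: contraNneq dt => lt0; have /(congr1 (horner^~ t)) := disc_XE sP.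
  by rewrite /disc_num hornerM lt0 mulr0 => <-.
have s0 : specialize t P != 0.
  by rewrite map_poly_eq0_id0 // -size_poly_gt0 ltnW.
apply: separable_of_resultant => //; rewrite /specialize deriv_map.
rewrite -map_resultant //.
  by move: dt; rewrite hornerM mulf_eq0 negb_or => /andP[].
rewrite /= /horner_eval lead_coef_deriv_rat // hornerMn -mulr_natr mulf_neq0 //.
by rewrite Num.Theory.pnatr_eq0; case: (size P) sP => [|[]].
Qed.

Lemma irreducible_root_minPoly (F : fieldType) (N : fieldExtType F)
    (p : {poly F}) (z : N) :
  irreducible_poly p -> root (map_poly (in_alg N) p) z ->
  map_poly (in_alg N) p %= minPoly 1 z.
Proof.
move=> [_ irr_p] pz; have /polyOver1P[q Dq] := minPolyOver 1 z.
rewrite Dq eqp_map eqp_sym irr_p //.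
  by rewrite -(size_map_poly (in_alg N)) -Dq size_minPoly.
rewrite -(dvdp_map (in_alg N)) -Dq; apply: minPoly_dvdp => //.
by apply/polyOver1P; exists p.
Qed.

Lemma galois_char0 (F : fieldType) (N : splittingFieldType F) : has_char0 F ->
  galois 1 {:N}.
Proof.
move=> F0; rewrite /galois sub1v normalFieldf andbT /=; apply/separableP => x _.
by apply: pcharf0_separable => p; rewrite pchar_lalg F0.
Qed.

Lemma QT_char0 : has_char0 QT.
Proof.
by move=> p; rewrite (fmorph_pchar (@tofrac _ \o polyC)) Num.Theory.pchar_num.
Qed.

Lemma uniq_map_inj (T U : eqType) (f : T -> U) (s : seq T) :
  uniq (map f s) -> {in s &, injective f}.
Proof.
move=> Uf x y sx sy eq_f; rewrite -(nth_index x sx) -(nth_index x sy).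
congr nth; apply/eqP; rewrite -(nth_uniq (f x) _ _ Uf) ?size_map ?index_mem //.
by rewrite !(nth_map x) ?index_mem // !nth_index // eq_f.
Qed.

Lemma alg_root_gal (F : fieldType) (N : splittingFieldType F) (q : {poly F})
    (s : gal_of {:N}) z :
  root (map_poly (in_alg N) q) z -> root (map_poly (in_alg N) q) (s z).
Proof.
move=> qz; have <- : map_poly s (map_poly (in_alg N) q) = map_poly (in_alg N) q.
  by rewrite -map_poly_comp; apply: eq_map_poly => c /=; rewrite rmorph_alg.
exact: rmorph_root.
Qed.

Lemma alg_eq0 (F : fieldType) (A : lalgType F) (c : F) :
  (c%:A == 0 :> A) = (c == 0).
Proof. by rewrite scaler_eq0 oner_eq0 orbF. Qed.

Lemma gal_eq_on (F : fieldType) (N : splittingFieldType F) (ys : seq N)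
    (s s' : gal_of {:N}) :
  <<1 & ys>>%VS = fullv -> {in ys, s =1 s'} -> s = s'.
Proof.
move=> gen eq_s; apply/(mulIg s'^-1)%g; rewrite mulgV.
apply/eqP/gal_eqP => x _; rewrite gal_id.
suff /mem_fixedFieldP[_ fx] : x \in fixedField [set (s * s'^-1)%g].
  by apply: fx; rewrite inE.
suff : (<<1 & ys>> <= fixedField [set (s * s'^-1)%g])%VS.
  by move/subvP; apply; rewrite gen memvf.
apply/Fadjoin_seqP; split=> [|y ys_y]; first exact: sub1v.
apply/fixedFieldP=> [|u /set1P->]; first exact: memvf.
by rewrite galM ?memvf // eq_s // -galM ?memvf // mulgV gal_id.
Qed.

Lemma nat_nonroot (E : fieldType) (p : {poly E}) : has_char0 E ->
  p != 0 -> exists n, p.[n%:R] != 0.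
Proof.
move=> /pcharf0P E0 p0; apply: contrapT => no_n.
have root_p n : root p n%:R.
  by apply/idPn => pn; case: no_n; exists n.
pose rs := [seq n%:R : E | n <- iota 0 (size p)].
suff : (size rs < size p)%N by rewrite size_map size_iota ltnn.
apply: max_poly_roots p0 _ _; first by apply/allP=> _ /mapP[n _ ->].
have inj_le m n : (m <= n)%N -> m%:R = n%:R :> E -> m = n.
  move=> le_mn /esym/eqP; rewrite -subr_eq0 -natrB // E0 subn_eq0 => le_nm.
  by apply/eqP; rewrite eqn_leq le_mn.
rewrite map_inj_uniq ?iota_uniq // => m n eq_mn.
by have [/inj_le->|/inj_le->] := orP (leq_total m n).
Qed.

(** * Places *)

(** A ring morphism from a local subring of K to E, whose kernel is the maximal
    ideal.  It is represented by its graph, so that a morphism is extended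
    simply by adding pairs to a subring of K * E: [graph_fun] makes the subring
    the graph of a function, [graph_inv] makes the domain local. *)
Record place (K E : fieldType) := Place {
  graph :> subringClosed (K * E)%type;
  graph_fun : forall y, (0, y) \in graph -> y = 0;
  graph_inv : forall x y, (x, y) \in graph -> y != 0 -> (x^-1, y^-1) \in graph }.

Section Localization.
Variables (K E : fieldType) (R : comNzRingType) (R0 : subringClosed R).
Variable j : {rmorphism R -> (K * E)%type}.
Hypothesis j_fun : forall a, a \in R0 -> (j a).1 = 0 -> (j a).2 = 0.

Definition fractions : {pred K * E} := fun z =>
  `[< exists a b, [/\ a \in R0, b \in R0, (j b).2 != 0 & z * j b = j a] >].

Lemma fractionsP z : reflect
  (exists a b, [/\ a \in R0, b \in R0, (j b).2 != 0 & z * j b = j a])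
  (z \in fractions).
Proof. exact: asboolP. Qed.

Lemma fractions_closed : subring_closed fractions.
Proof.
split.
- by apply/fractionsP; exists 1, 1; rewrite rpred1 rmorph1 mul1r oner_neq0.
- move=> z z' /fractionsP[a [b [aR bR b0 e]]].
  move=> /fractionsP[a' [b' [aR' bR' b0' e']]].
  apply/fractionsP; exists (a * b' - a' * b), (b * b').
  split; rewrite ?rpredB ?rpredM // ?rmorphM ?rmorphB /= ?mulf_neq0 //.
  by rewrite !rmorphM -e -e' /=; ring.
- move=> z z' /fractionsP[a [b [aR bR b0 e]]].
  move=> /fractionsP[a' [b' [aR' bR' b0' e']]].
  apply/fractionsP; exists (a * a'), (b * b').
  split; rewrite ?rpredM // ?rmorphM /= ?mulf_neq0 //.
  by rewrite -e -e' /=; ring.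
Qed.

Lemma mem_fractions a : a \in R0 -> j a \in fractions.
Proof.
move=> aR; apply/fractionsP; exists a, 1.
by rewrite rpred1 rmorph1 mulr1 oner_neq0.
Qed.

Lemma fractions_fun x y : (x, y) \in fractions -> x = 0 -> y = 0.
Proof.
move=> /fractionsP[a [b [aR bR b0 e]]] x0.
have /eqP := congr1 snd e; rewrite /= (j_fun aR); last first.
  by rewrite -e /= x0 mul0r.
by rewrite mulf_eq0 (negPf b0) orbF => /eqP.
Qed.

Lemma fractions_inv x y :
  (x, y) \in fractions -> y != 0 -> (x^-1, y^-1) \in fractions.
Proof.
move=> Sxy y0; have x0 : x != 0 by apply: contra_neq y0; apply: fractions_fun.
have /fractionsP[a [b [aR bR b0 e]]] := Sxy.
apply/fractionsP; exists b, a; split=> //; first by rewrite -e mulf_neq0.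
by rewrite -e; apply/eqP; rewrite -pair_eqE /pair_eq /= !mulKf ?eqxx.
Qed.

(** Inverting all elements with nonzero second component is enough to make a
    place out of a ring morphism to K * E, as soon as the second component
    vanishes together with the first. *)
Lemma place_of_fractions :
  exists S : place K E, forall a, a \in R0 -> j a \in S.
Proof.
pose SM := GRing.isSubringClosed.Build _ fractions fractions_closed.
pose G : subringClosed (K * E)%type := HB.pack fractions SM.
have G_fun y : (0, y) \in G -> y = 0 by move/fractions_fun; apply.
by exists (@Place _ _ G G_fun fractions_inv); exact: mem_fractions.
Qed.
End Localization.

Lemma size_cancel_lead (R : nzRingType) (p g : {poly R}) c :
    p != 0 -> (size g <= size p)%N -> c * lead_coef g = lead_coef p ->
  (size (p - c%:P * ('X^(size p - size g) * g))%R < size p)%N.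
Proof.
rewrite -size_poly_gt0 /lead_coef => p0 le_gp eq_lead.
set k := (size p - size g)%N.
rewrite -[X in (_ < X)%N](ltn_predK p0) ltnS; apply/leq_sizeP => i le_i.
rewrite coefB coefCM coefXnM ltnNge.
have [g0|g0] := posnP (size g).
  have pl0 : p`_(size p).-1 = 0 by rewrite -eq_lead nth_default ?mulr0 ?g0.
  by move: p0; rewrite size_poly_gt0 -lead_coef_eq0 /lead_coef pl0 eqxx.
have -> /= : (k <= i)%N by rewrite /k; lia.
move: le_i; rewrite leq_eqVlt => /predU1P[<-|lt_i]; last first.
  have le_pi : (size p <= i)%N by lia.
  have le_gi : (size g <= i - k)%N by rewrite /k; lia.
  by rewrite (nth_default 0 le_pi) (nth_default 0 le_gi) mulr0 subr0.
have -> : ((size p).-1 - k = (size g).-1)%N by rewrite /k; lia.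
by rewrite eq_lead subrr.
Qed.

Section Extension.
Variables (K E : fieldType) (S : place K E).
Variable a : K.

Local Notation poly1 := (map_poly (fst : K * E -> K)).
Local Notation poly2 := (map_poly (snd : K * E -> E)).

Lemma place_neq0 z : z \in S -> z.2 != 0 -> z.1 != 0.
Proof.
case: z => x y /= Sxy; apply: contraNneq => x0.
by rewrite (@graph_fun _ _ S y) // -x0.
Qed.

Lemma place_inv z : z \in S -> z.2 != 0 ->
  exists2 z', z' \in S & z' * z = 1.
Proof.
move=> Sz z2; have z1 := place_neq0 Sz z2; exists (z.1^-1, z.2^-1).
  by apply: graph_inv => //; rewrite -surjective_pairing.
by apply/eqP; rewrite -pair_eqE /pair_eq /= !mulVf ?eqxx.
Qed.

(** The maximal ideal m of the place does not generate the unit ideal of the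
    ring obtained by adjoining an integral element a: for c nonzero, p would be
    a relation on a whose coefficients, except the constant one, are in m.  The proof is a
    descent on the lengths of p and g.  If p is at least as long as g, its
    leading coefficient has value 0, and cancelling it against g does not affect
    the value of p.  If p is shorter, then g - (g_0 / p_0) p is still monic and
    has no constant term; dividing it by X gives a shorter monic relation, since
    a is not 0. *)
Lemma integral_relation_proper (p g : {poly K * E}) c :
    p \is a polyOver S -> g \is a polyOver S -> g \is monic ->
    root (poly1 p) a -> root (poly1 g) a -> poly2 p = c%:P -> c = 0.
Proof.
have [n le_n] := ubnP (size p + size g).
elim: n => // n IHn in p g le_n *; move=> Sp Sg mon_g pa ga p2.
apply/eqP/idPn=> c0.
have g0 : g != 0 by rewrite monic_neq0.
have Sp0 : p`_0 \in S by rewrite (polyOverP Sp).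
have p02 : (p`_0).2 = c.
  by have := congr1 (coefp 0) p2; rewrite /= coef_map coefC.
have p01 : (p`_0).1 != 0 by rewrite place_neq0 // p02.
have [sp|sp] := leqP (size p) 1.
  move: pa; rewrite (size1_polyC sp) map_polyC /= rootC.
  by apply/negP.
have [sg|sg] := leqP (size g) 1.
  move: mon_g ga; rewrite (size1_polyC sg) monicE lead_coefC => /eqP->.
  by rewrite polyC1 rmorph1 (negPf (root1 _)).
have [le_gp|lt_pg] := leqP (size g) (size p).
  pose b := lead_coef p; pose k := (size p - size g)%N.
  have Sb : b \in S by rewrite (polyOverP Sp).
  have b2 : b.2 = 0.
    have := congr1 (coefp (size p).-1) p2; rewrite /= coef_map coefC /=.
    by rewrite gtn_eqF // -subn1 subn_gt0.
  pose p' := p - b%:P * ('X^k * g).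
  have sp' : (size p' < size p)%N.
    apply: size_cancel_lead => //; first by rewrite -size_poly_gt0 ltnW.
    by rewrite (monicP mon_g) mulr1.
  suff c0' : c = 0 by rewrite c0' eqxx in c0.
  apply: (IHn p' g) => //.
  - by rewrite -ltnS (leq_trans _ le_n) // ltnS ltn_add2r.
  - by rewrite rpredB ?rpredM ?polyOverC ?rpredX ?polyOverX.
  - rewrite rmorphB !rmorphM rootE hornerD hornerN !hornerM.
    by rewrite (rootP pa) (rootP ga) !mulr0 subr0.
  - by rewrite rmorphB !rmorphM /= map_polyC /= b2 mul0r subr0.
have [z Sz zp0] := place_inv Sp0 (eq_ind_r (fun x => x != 0) c0 p02).
pose g' := g - (g`_0 * z)%:P * p.
have Sg' : g' \is a polyOver S.
  by rewrite rpredB ?rpredM ?polyOverC ?rpredM ?(polyOverP Sg).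
have g'0 : root g' 0.
  by rewrite rootE !hornerE !horner_coef0 -mulrA zp0 mulr1 subrr.
have [h Dg'] := factor_theorem _ _ g'0; rewrite subr0 in Dg'.
have szp : (size ((g`_0 * z)%:P * p)%R < size g)%N.
  by apply: leq_ltn_trans lt_pg; rewrite mul_polyC size_scale_leq.
have sg' : size g' = size g by rewrite size_polyDl ?size_polyN.
have mon_h : h \is monic.
  rewrite monicE -(monicP mon_g) -(lead_coef_Mmonic _ (monicX _)) -Dg'.
  by rewrite lead_coefDl ?size_polyN.
suff c0' : c = 0 by rewrite c0' eqxx in c0.
apply: (IHn p h) => //.
- have sh : (size h).+1 = size g by rewrite -sg' Dg' size_mulX // monic_neq0.
  by rewrite -ltnS -addnS sh.
- by apply/polyOverP=> i; move/polyOverP/(_ i.+1): Sg'; rewrite Dg' coefMX.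
- have a0 : a != 0.
    apply: contraNneq p01 => a0; move: pa.
    by rewrite a0 rootE horner_coef0 coef_map.
  have := congr1 (fun q => (poly1 q).[a]) Dg'.
  rewrite /= rmorphB !rmorphM /= map_polyX !hornerE (rootP ga) (rootP pa).
  by rewrite mulr0 subr0 => /esym/eqP; rewrite mulf_eq0 (negPf a0) orbF.
Qed.

(** The values of the relations on a form an ideal over the residue field.  Its
    generator is the value of a relation d, taken so that this value is nonzero
    of least degree; it is not constant by [integral_relation_proper], and it
    divides the value of g, which splits. *)
Lemma integral_place_root (g : {poly K * E}) rs :
    g \is a polyOver S -> g \is monic -> root (poly1 g) a ->
    poly2 g %= \prod_(z <- rs) ('X - z%:P) ->
  exists b, forall p, p \is a polyOver S ->
    root (poly1 p) a -> root (poly2 p) b.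
Proof.
move=> Sg mon_g ga g2.
pose I p := [/\ p \is a polyOver S, root (poly1 p) a & poly2 p != 0].
have g20 : poly2 g != 0 by rewrite monic_neq0 // monic_map.
have [d [Sd da d0] min_d] : exists2 d, I d &
    forall p, I p -> (size (poly2 d) <= size (poly2 p))%N.
  have exI : exists n, `[< exists2 p, I p & size (poly2 p) = n >].
    by exists (size (poly2 g)); apply/asboolP; exists g.
  case: (ex_minnP exI) => m /asboolP[d Id <-] min_m; exists d => // p Ip.
  by apply: min_m; apply/asboolP; exists p.
have dvd_d p : p \is a polyOver S -> root (poly1 p) a -> poly2 d %| poly2 p.
  have [n le_n] := ubnP (size (poly2 p)).
  elim: n => // n IHn in p le_n * => Sp pa.
  have [->|p0] := eqVneq (poly2 p) 0; first exact: dvdp0.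
  have le_dp := min_d p (And3 Sp pa p0).
  pose k := (size (poly2 p) - size (poly2 d))%N.
  pose dl := d`_(size (poly2 d)).-1; pose pl := p`_(size (poly2 p)).-1.
  have dl2 : dl.2 = lead_coef (poly2 d) by rewrite /lead_coef coef_map.
  have pl2 : pl.2 = lead_coef (poly2 p) by rewrite /lead_coef coef_map.
  have Sdl : dl \in S by rewrite (polyOverP Sd).
  have [|z Sz zdl] := place_inv Sdl; first by rewrite dl2 lead_coef_eq0.
  pose w := (pl * z)%:P * ('X^k * d).
  have Sw : w \is a polyOver S.
    by rewrite !(rpredM, polyOverC, rpredX, polyOverX) ?(polyOverP Sp).
  have dvd_w : poly2 d %| poly2 w by rewrite !rmorphM /= mulrA dvdp_mulIr.
  rewrite -(subrK w p) rmorphD /= dvdp_add //.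
  apply: IHn; last 1 first.
  - rewrite rmorphB !rmorphM rootE hornerD hornerN !hornerM.
    by rewrite (rootP pa) (rootP da) !mulr0 subr0.
  - apply: leq_trans (le_n : (_ <= n)%N).
    rewrite rmorphB !rmorphM /= !map_polyC map_polyXn /= -polyCM.
    apply: size_cancel_lead => //; rewrite -pl2 -dl2 -mulrA.
    by have /= -> := congr1 snd zdl; rewrite mulr1.
  - by rewrite rpredB.
have d2 : size (poly2 d) != 1%N.
  apply/size_poly1P => -[c c0 Dc].
  by rewrite (integral_relation_proper Sd Sg mon_g da ga Dc) eqxx in c0.
have : poly2 d %| \prod_(z <- rs) ('X - z%:P) by rewrite -(eqp_dvdr _ g2) dvd_d.
case/dvdp_prod_XsubC=> m Dd.
case: (mask m rs) Dd => [|b s] Dd.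
  by move: d2; rewrite (eqp_size Dd) big_nil size_poly1.
exists b => p Sp pa.
apply: (@root_dvdp _ _ _ b (dvd_d p Sp pa)).
by rewrite (eqp_root Dd) big_cons rootM root_XsubC eqxx.
Qed.

(** Sending a to a common root b of the values of all relations on a makes
    evaluation at (a, b) well defined on polynomials over the place. *)
Lemma place_extension (g : {poly K * E}) rs :
    g \is a polyOver S -> g \is monic -> root (poly1 g) a ->
    poly2 g %= \prod_(z <- rs) ('X - z%:P) ->
  exists S' : place K E, {subset S <= S'} /\ exists b, (a, b) \in S'.
Proof.
move=> Sg mon_g ga g2; have [b Sb] := integral_place_root Sg mon_g ga g2.
have eval1 p : p.[(a, b)].1 = (poly1 p).[a] by rewrite -horner_map.
have eval2 p : p.[(a, b)].2 = (poly2 p).[b] by rewrite -horner_map.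
pose j : {rmorphism {poly (K * E)%type} -> (K * E)%type} := horner_eval (a, b).
pose SM := GRing.isSubringClosed.Build _ (polyOver S : {pred _})
  (And3 (rpred1 _) (@rpredB _ _) (@rpredM _ _)).
pose R0 : subringClosed _ := HB.pack (polyOver S : {pred _}) SM.
have [p Sp|S' SS'] := @place_of_fractions K E _ R0 j.
  rewrite /= /horner_eval eval1 eval2 => /rootP pa.
  by apply/rootP/Sb.
exists S'; split=> [z Sz|].
  by have := SS' z%:P; rewrite /= /horner_eval hornerC polyOverC; apply.
by exists b; have := SS' 'X; rewrite /= /horner_eval hornerX polyOverX; apply.
Qed.
End Extension.

Section PlaceMap.
Variables (K E : fieldType) (S : place K E).

(** The default value 0 is taken outside of the domain. *)
Definition value (x : K) : E :=
  if pselect (exists y, (x, y) \in S) is left Sx then xchoose Sx else 0.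
Definition regular : {pred K} := fun x => (x, value x) \in S.

Lemma valueP x y : (x, y) \in S -> x \in regular /\ value x = y.
Proof.
move=> Sxy; have Sx : x \in regular.
  rewrite unfold_in /= /value; case: pselect => [Sx|[]]; last by exists y.
  exact: (xchooseP Sx).
split=> //; apply/eqP; rewrite -subr_eq0; apply/eqP/(@graph_fun _ _ S).
by have := rpredB Sx Sxy; rewrite -[_ - _]/(x - x, value x - y) subrr.
Qed.

Lemma mem_graph x : x \in regular -> (x, value x) \in S. Proof. by []. Qed.

Lemma regularP x : reflect (exists y, (x, y) \in S) (x \in regular).
Proof.
by apply: (iffP idP) => [Sx|[y /valueP[]//]]; exists (value x).
Qed.

Lemma regular_closed : subring_closed regular.
Proof.
split=> [|x y Sx Sy|x y Sx Sy]; apply/regularP.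
- by exists 1; apply: (rpred1 S).
- by exists (value x - value y); apply: (rpredB (mem_graph Sx) (mem_graph Sy)).
- by exists (value x * value y); apply: (rpredM (mem_graph Sx) (mem_graph Sy)).
Qed.

HB.instance Definition _ := GRing.isSubringClosed.Build K regular regular_closed.

Lemma value_sum (I : Type) (s : seq I) (P : pred I) F :
    (forall i, P i -> F i \in regular) ->
  value (\sum_(i <- s | P i) F i) = \sum_(i <- s | P i) value (F i).
Proof.
move=> SF; apply: proj2 (valueP _).
elim/big_rec2: _ => [|i y x Pi Sxy]; first exact: (rpred0 S).
exact: (rpredD (mem_graph (SF i Pi)) Sxy).
Qed.

Lemma value_prod (I : Type) (s : seq I) (P : pred I) F :
    (forall i, P i -> F i \in regular) ->
  value (\prod_(i <- s | P i) F i) = \prod_(i <- s | P i) value (F i).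
Proof.
move=> SF; apply: proj2 (valueP _).
elim/big_rec2: _ => [|i y x Pi Sxy]; first exact: (rpred1 S).
exact: (rpredM (mem_graph (SF i Pi)) Sxy).
Qed.

Lemma value1 : value 1 = 1.
Proof. by apply: proj2 (valueP _); apply: (rpred1 S). Qed.

Lemma value0 : value 0 = 0.
Proof. by apply: proj2 (valueP _); apply: (rpred0 S). Qed.

Lemma value_nat n : n%:R \in regular /\ value n%:R = n%:R.
Proof.
apply: valueP; elim: n => [|n IHn]; first exact: (rpred0 S).
by rewrite !mulrS; exact: (rpredD (rpred1 S) IHn).
Qed.

Lemma valueB : {in regular &, {morph value : x y / x - y}}.
Proof.
move=> x y Sx Sy; apply: proj2 (valueP _).
exact: (rpredB (mem_graph Sx) (mem_graph Sy)).
Qed.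

Lemma valueM : {in regular &, {morph value : x y / x * y}}.
Proof.
move=> x y Sx Sy; apply: proj2 (valueP _).
exact: (rpredM (mem_graph Sx) (mem_graph Sy)).
Qed.

Lemma valueX n : {in regular, {morph value : x / x ^+ n}}.
Proof.
move=> x Sx; elim: n => [|n IHn]; first by rewrite !expr0 value1.
by rewrite !exprS valueM ?rpredX // IHn.
Qed.

Lemma value_horner p x : p \is a polyOver regular -> x \in regular ->
  value p.[x] = (map_poly value p).[value x].
Proof.
move=> Sp Sx; have Spi i : p`_i \in regular by rewrite (polyOverP Sp).
rewrite (horner_coef_wide _ (size_poly _ _)) horner_coef.
rewrite value_sum => [|i _]; last first.
  by rewrite rpredM ?rpredX.
by apply: eq_bigr => i _; rewrite valueM ?rpredX // valueX // coef_poly ltn_ord.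
Qed.

Lemma regular_div x y : x * y \in regular -> y \in regular -> value y != 0 ->
  x \in regular.
Proof.
move=> Sxy Sy y0; have Sy' : y^-1 \in regular.
  by apply/regularP; exists (value y)^-1; apply: graph_inv.
have [y00|ynz] := eqVneq y 0; first by rewrite y00 value0 eqxx in y0.
by rewrite -(mulfK ynz x) rpredM.
Qed.

(** Identities between polynomials over K are transported to E by lifting both
    sides to polynomials over the graph. *)
Lemma map_value_fst (p : {poly K * E}) : p \is a polyOver S ->
  map_poly value (map_poly fst p) = map_poly snd p.
Proof.
move=> Sp; apply/polyP=> i; rewrite coef_map_id0 ?value0 // !coef_map /=.
by apply: proj2 (valueP _); rewrite -surjective_pairing (polyOverP Sp).
Qed.

Lemma map_valueZ c (p : {poly K}) : c \in regular -> p \is a polyOver regular ->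
  map_poly value (c *: p) = value c *: map_poly value p.
Proof.
move=> Sc Sp; apply/polyP=> i; rewrite coefZ !coef_map_id0 ?value0 // coefZ.
by rewrite valueM // (polyOverP Sp).
Qed.

Lemma map_value_prod_XsubC (I : Type) (s : seq I) (P : pred I) F :
    (forall i, P i -> F i \in regular) ->
  map_poly value (\prod_(i <- s | P i) ('X - (F i)%:P))
    = \prod_(i <- s | P i) ('X - (value (F i))%:P).
Proof.
move=> SF; pose q := \prod_(i <- s | P i) ('X - (F i, value (F i))%:P).
have Sq : q \is a polyOver S.
  rewrite rpred_prod // => i Pi; rewrite rpredB ?polyOverX ?polyOverC //.
  exact/mem_graph/SF.
have /= := map_value_fst Sq; rewrite !rmorph_prod /=.
under eq_bigr do rewrite rmorphB /= map_polyX map_polyC.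
by move=> ->; apply: eq_bigr => i _; rewrite rmorphB /= map_polyX map_polyC.
Qed.

End PlaceMap.

Lemma place_extension_seq (K E : fieldType) (S : place K E)
    (g : {poly K * E}) rs (s : seq K) :
    g \is a polyOver S -> g \is monic ->
    {in s, forall a, root (map_poly fst g) a} ->
    map_poly snd g %= \prod_(z <- rs) ('X - z%:P) ->
  exists S' : place K E, {subset S <= S'} /\ {subset s <= regular S'}.
Proof.
move=> Sg mon_g; elim: s => [|a s IHs] ga g2; first by exists S; split.
have [|S1 [SS1 s1]] := IHs _ g2.
  by move=> z sz; apply: ga; rewrite inE sz orbT.
have Sg1 : g \is a polyOver S1 by apply: polyOverS Sg.
have [S2 [SS2 [b S2b]]] := place_extension Sg1 mon_g (ga a (mem_head _ _)) g2.
exists S2; split=> [z /SS1/SS2 //|z /[!inE] /predU1P[->|/s1 Sz]].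
  by apply/regularP; exists b.
by apply/regularP; exists (value S1 z); apply: SS2.
Qed.

(** * Integral elements *)

Section Integral.
Variables (F : fieldType) (N : splittingFieldType F) (A : comNzRingType).
Variable jA : {rmorphism A -> F}.

Definition integral : {pred N} :=
  fun x => `[< integralOver (in_alg N \o jA) x >].

Lemma integralP x : reflect (integralOver (in_alg N \o jA) x) (x \in integral).
Proof. exact: asboolP. Qed.

Lemma integral_closed : subring_closed integral.
Proof.
split=> [|x y /integralP Ix /integralP Iy|x y /integralP Ix /integralP Iy].
- exact/integralP/integral1.
- exact/integralP/integral_sub.
- exact/integralP/integral_mul.
Qed.

HB.instance Definition _ := GRing.isSubringClosed.Build N integral integral_closed.

Lemma integral_gal (s : gal_of {:N}) x : x \in integral -> s x \in integral.
Proof.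
move=> /integralP[p mon_p px]; apply/integralP; exists p => //.
have <- : map_poly s (map_poly (in_alg N \o jA) p) = map_poly (in_alg N \o jA) p.
  by rewrite -map_poly_comp; apply: eq_map_poly => c /=; rewrite rmorph_alg.
exact: rmorph_root.
Qed.

Lemma integral_alg (c : F) : c%:A \in integral -> integralOver jA c.
Proof.
move=> /integralP[p mon_p pc]; exists p => //.
by rewrite map_poly_comp fmorph_root in pc.
Qed.
End Integral.

(** With l the leading coefficient of p and n + 1 its degree, l * x is a root of
    the monic polynomial l ^ n * p(X / l). *)
Lemma integral_lead_mul (A : comNzRingType) (K : fieldType) (f : {rmorphism A -> K})
    (p : {poly A}) x :
  root (map_poly f p) x -> integralOver f (f (lead_coef p) * x).
Proof.
move=> px; set l := lead_coef p; case Dn: (size p) => [|[|n]].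
- by rewrite /l /lead_coef Dn nth_default ?Dn // rmorph0 mul0r; apply: integral0.
- have sp : (size p <= 1)%N by rewrite Dn.
  move: px; rewrite (size1_polyC sp) map_polyC rootC /= => /eqP p0.
  by rewrite /l /lead_coef Dn /= p0 mul0r; apply: integral0.
pose h : {poly A} := \poly_(i < n.+1) (p`_i * l ^+ (n - i)).
pose xn : {poly A} := 'X^(n.+1).
have sh : (size h < size xn)%N.
  by rewrite size_polyXn ltnS size_poly.
exists (xn + h); first by rewrite monicE lead_coefDl // lead_coefXn.
have sp : (size (map_poly f p) <= n.+2)%N by rewrite -Dn size_poly.
have sfh : (size (map_poly f h) <= n.+1)%N.
  by rewrite (leq_trans (size_poly _ _)) ?size_poly.
have Dl : p`_n.+1 = l by rewrite /l /lead_coef Dn.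
rewrite rmorphD /= map_polyXn rootE hornerD hornerXn (horner_coef_wide _ sfh).
suff <- : f l ^+ n * (map_poly f p).[x] = (f l * x) ^+ n.+1 +
    \sum_(i < n.+1) (map_poly f h)`_i * (f l * x) ^+ i by rewrite (rootP px) mulr0.
rewrite (horner_coef_wide _ sp) big_ord_recr /= coef_map Dl mulrDr addrC.
congr (_ + _); first by rewrite mulrA -exprSr exprMn.
rewrite mulr_sumr; apply: eq_bigr => i _; rewrite !coef_map coef_poly ltn_ord /=.
rewrite rmorphM rmorphXn exprMn -{1}(subnK (ltnSE (ltn_ord i))) exprD.
by ring.
Qed.

(** * The decomposition group *)

Section Decomposition.
Variables (F k : fieldType) (N : splittingFieldType F) (L : splittingFieldType k).
Variables (A : comNzRingType) (jA : {rmorphism A -> F}) (S : place N L).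
Local Notation G := 'Gal({:N} / 1%VS)%g.
Local Notation H := 'Gal({:L} / 1%VS)%g.
Local Notation integral := (@integral F N A jA).
Local Notation regular := (regular S).
Local Notation value := (value S).

Hypothesis galN : galois 1 {:N}.
Hypothesis charL : has_char0 L.
Hypothesis base_value : forall c, integralOver jA c ->
  exists q : k, (c%:A, q%:A) \in S.
(** In the application, ys lists the roots of P, scaled so as to be integral. *)
Variable ys : seq N.
Hypothesis ys_int : {subset ys <= integral}.
Hypothesis ys_reg : {subset ys <= regular}.
Hypothesis ys_gen : <<1 & ys>>%VS = fullv.
Hypothesis ys_gal : forall (s : gal_of {:N}) y, y \in ys -> s y \in ys.
Hypothesis ys_inj : {in ys &, injective value}.

Lemma gal_inG (s : gal_of {:N}) : s \in G.
Proof. by rewrite gal_kHom ?sub1v // k1HomE ahomWin. Qed.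

Lemma fixed_value c : c \in integral -> (forall s, s \in G -> s c = c) ->
  c \in regular /\ value c \in 1%VS.
Proof.
move=> Ic fix_c; have /vlineP[c0 Dc] : c \in 1%VS.
  rewrite -(galois_fixedField galN).
  by apply/fixedFieldP=> //; exact: memvf.
rewrite Dc in Ic *; have [q /valueP[-> ->]] := base_value (integral_alg Ic).
by split=> //; apply/vlineP; exists q.
Qed.

Lemma fixed_poly_value (p : {poly N}) : p \is a polyOver integral ->
    (forall s : gal_of {:N}, s \in G -> map_poly s p = p) ->
  p \is a polyOver regular /\ map_poly value p \is a polyOver 1%VS.
Proof.
move=> Ip fix_p.
have fix_pi i : p`_i \in regular /\ value p`_i \in 1%VS.
  apply: fixed_value => [|s Gs]; first by rewrite (polyOverP Ip).
  by rewrite -[in RHS](fix_p s Gs) coef_map.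
split; apply/polyOverP=> i; first by case: (fix_pi i).
by rewrite coef_map_id0 ?value0 //; case: (fix_pi i).
Qed.

(** The element is a = sum_i y_i n^i.  If a and s a have the same value, then n
    is a root of the polynomial D s with coefficients value (s y_i) - value y_i,
    which is nonzero unless s = 1; so n is chosen outside the finitely many
    roots of the polynomials D s. *)
Lemma separating_element : exists a, [/\ a \in integral,
    forall s : gal_of {:N}, s a \in regular &
    forall s : gal_of {:N}, value (s a) = value a -> s = 1%g].
Proof.
pose D (s : gal_of {:N}) := \poly_(i < size ys) (value (s ys`_i) - value ys`_i).
have D0 s : s != 1%g -> D s != 0.
  apply: contra_neq => Ds0; apply: (gal_eq_on ys_gen) => y ys_y.
  rewrite gal_id; apply: ys_inj => //; first exact: ys_gal.
  have := congr1 (coefp (index y ys)) Ds0.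
  rewrite /= coef_poly index_mem ys_y coef0 nth_index // => /eqP.
  by rewrite subr_eq0 => /eqP.
have [|n] := @nat_nonroot L (\prod_(s | s != 1%g) D s) charL.
  by apply/prodf_neq0 => s /D0.
rewrite horner_prod => /prodf_neq0 nDs.
have [reg_n val_n] := value_nat S n.
pose a : N := \sum_(i < size ys) ys`_i * n%:R ^+ i.
have sa (s : gal_of {:N}) : s a = \sum_(i < size ys) s ys`_i * n%:R ^+ i.
  rewrite rmorph_sum; apply: eq_bigr => i _.
  by rewrite rmorphM rmorphXn rmorph_nat.
have reg_i (s : gal_of {:N}) (i : 'I_(size ys)) : s ys`_i * n%:R ^+ i \in regular.
  by rewrite rpredM ?rpredX // ys_reg // ys_gal // mem_nth.
have val_sa (s : gal_of {:N}) :
    value (s a) = \sum_(i < size ys) value (s ys`_i) * n%:R ^+ i.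
  rewrite sa value_sum //; apply: eq_bigr => i _.
  by rewrite valueM ?valueX ?rpredX // ?val_n // ys_reg // ys_gal // mem_nth.
exists a; split=> [|s|s val_s].
- rewrite rpred_sum // => i _.
  by rewrite rpredM ?rpredX ?rpred_nat // ys_int // mem_nth.
- by rewrite sa rpred_sum.
apply/eqP/idPn => s1; case/eqP: (nDs s s1).
have val_a : value a = \sum_(i < size ys) value ys`_i * n%:R ^+ i.
  rewrite -[in LHS](gal_id {:N} a) val_sa.
  by apply: eq_bigr => i _; rewrite gal_id.
have := subrr (value a); rewrite -{1}val_s val_sa val_a -sumrB => e0.
by rewrite horner_poly -[RHS]e0; apply: eq_bigr => i _; rewrite mulrBl.
Qed.

Section Interpolation.
Variable a : N.
Hypothesis a_int : a \in integral.
Hypothesis a_reg : forall s : gal_of {:N}, s a \in regular.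
Hypothesis a_sep : forall s : gal_of {:N}, value (s a) = value a -> s = 1%g.

(** Lagrange interpolation of the map s a |-> s x on the conjugates of a, with
    the denominators cleared. *)
Definition conj_interp (x : N) : {poly N} :=
  \sum_(s in G) (s x)%:P * \prod_(u in G | u != s) ('X - (u a)%:P).
(** The derivative at a of the product of the X - u a, by which x is multiplied
    in the value of [conj_interp] at a. *)
Definition different : N := \prod_(u in G | u != 1%g) (a - u a).

Lemma conj_interp_eval x : (conj_interp x).[a] = x * different.
Proof.
rewrite /conj_interp (bigD1 1%g) ?group1 //= hornerD hornerM hornerC gal_id.
rewrite horner_prod horner_sum [X in _ + X]big1 ?addr0 => [|s /andP[_ s1]].
  by congr (_ * _); apply: eq_bigr => u _; rewrite !hornerE.
rewrite hornerM horner_prod (bigD1 1%g) /= ?group1 1?eq_sym //.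
by rewrite !hornerE gal_id /= subrr mulr0 mul0r.
Qed.

Lemma map_gal_XsubC (s u : gal_of {:N}) b :
  map_poly s ('X - (u b)%:P) = 'X - ((u * s)%g b)%:P.
Proof. by rewrite rmorphB /= map_polyX map_polyC /= galM ?memvf. Qed.

Lemma conj_interp_fixed x (s : gal_of {:N}) :
  s \in G -> map_poly s (conj_interp x) = conj_interp x.
Proof.
move=> Gs; rewrite rmorph_sum [RHS](reindex_inj (mulIg s)) /=.
apply: eq_big => [u|u Gu]; first by rewrite groupMr.
rewrite rmorphM rmorph_prod /= map_polyC /= -galM ?memvf //; congr (_ * _).
rewrite [RHS](reindex_inj (mulIg s)) /=.
apply: eq_big => [v|v _]; last exact: map_gal_XsubC.
by rewrite groupMr // (inj_eq (mulIg s)).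
Qed.

Lemma conj_interp_int x : x \in integral -> conj_interp x \is a polyOver integral.
Proof.
move=> Ix; rewrite rpred_sum // => s _; rewrite rpredM ?polyOverC ?integral_gal //.
by rewrite rpred_prod // => u _; rewrite rpredB ?polyOverX ?polyOverC ?integral_gal.
Qed.

Lemma a_regular : a \in regular.
Proof. by rewrite -(gal_id {:N} a). Qed.

Lemma different_regular : different \in regular.
Proof. by rewrite rpred_prod // => u _; rewrite rpredB ?a_regular. Qed.

Lemma different_value : value different != 0.
Proof.
rewrite value_prod => [|u _]; last by rewrite rpredB ?a_regular.
apply/prodf_neq0 => u /andP[_]; apply: contra_neq.
by rewrite valueB ?a_regular // => /eqP; rewrite subr_eq0 => /eqP/esym/a_sep.
Qed.

(** The coefficients of the interpolation polynomial of x are fixed by G and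
    integral, so the place is defined at them, hence at x * different; and
    different has a nonzero value since a is separated from its conjugates. *)
Lemma integral_regular_interp : {subset integral <= regular}.
Proof.
move=> x Ix; have Ip := conj_interp_int Ix.
have [Rx _] := fixed_poly_value Ip (conj_interp_fixed x).
apply: regular_div different_regular different_value.
by rewrite -conj_interp_eval rpred_horner ?a_regular.
Qed.

(** The values of the conjugates of a are the roots of a polynomial over k, so t
    maps value a to value (s a) for some s.  The interpolation polynomials of x
    and of 1 have values with coefficients in k; comparing them at a and at s a
    extends the equality t (value a) = value (s a) to x. *)
Lemma gal_lift_interp (t : gal_of {:L}) :
  exists2 s : gal_of {:N}, s \in G &
    {in integral, forall x, t (value x) = value (s x)}.
Proof.
have fix_t (p : {poly L}) z : p \is a polyOver 1%VS -> t p.[z] = p.[t z].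
  move=> p1; rewrite -horner_map; congr _.[_]; apply/polyP=> i.
  by rewrite coef_map; have /vlineP[q ->] := polyOverP p1 i; apply: rmorph_alg.
pose g : {poly N} := \prod_(u in G) ('X - (u a)%:P).
have [|s Gs|Rg g1] := @fixed_poly_value g.
- by rewrite rpred_prod // => u _; rewrite rpredB ?polyOverX ?polyOverC ?integral_gal.
- rewrite rmorph_prod [RHS](reindex_inj (mulIg s)) /=.
  by apply: eq_big => [u|u _]; [rewrite groupMr | exact: map_gal_XsubC].
have Dg : map_poly value g = \prod_(u in G) ('X - (value (u a))%:P).
  exact: map_value_prod_XsubC.
have : (map_poly value g).[t (value a)] = 0.
  rewrite -fix_t // Dg horner_prod (bigD1 1%g) ?group1 //=.
  by rewrite gal_id !hornerE subrr mul0r rmorph0.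
rewrite Dg horner_prod => /eqP/prodf_eq0[s Gs].
rewrite !hornerE subr_eq0 => /eqP ta; exists s => // x Ix.
have eq_interp y : y \in integral ->
    t (value y) * t (value different) = value (s y) * value (s different).
  move=> Iy; have Ip := conj_interp_int Iy.
  have [Ry y1] := fixed_poly_value Ip (conj_interp_fixed y).
  have In : different \in integral.
    by rewrite rpred_prod // => u _; rewrite rpredB ?integral_gal.
  have reg_int z : z \in integral -> z \in regular by apply: integral_regular_interp.
  rewrite -rmorphM -!valueM ?different_regular ?reg_int ?integral_gal //.
  rewrite -rmorphM -conj_interp_eval -horner_map /= conj_interp_fixed //.
  by rewrite !value_horner ?a_regular // fix_t // ta.
have := eq_interp 1 (rpred1 _); rewrite value1 !rmorph1 value1 !mul1r => tn.
have := eq_interp x Ix; rewrite tn; apply: mulIf.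
by rewrite -tn fmorph_eq0 different_value.
Qed.
End Interpolation.

Lemma integral_regular : {subset integral <= regular}.
Proof.
have [a [Ia Ra sep_a]] := separating_element.
exact: (integral_regular_interp Ia).
Qed.

Lemma gal_lift (t : gal_of {:L}) :
  exists2 s : gal_of {:N}, s \in G &
    {in integral, forall x, t (value x) = value (s x)}.
Proof.
have [a [Ia Ra sep_a]] := separating_element.
exact: (gal_lift_interp Ia).
Qed.

Hypothesis L_gen : <<1 & map value ys>>%VS = fullv.

(** The automorphism s that [gal_lift] attaches to t is unique, because the
    values of ys are distinct; this makes t |-> s a morphism, and it is injective
    because these values generate L. *)
Lemma decomposition_group : exists D : {group gal_of {:N}},
  [/\ D \subset G, H \isog D,
  forall s, s \in D -> exists t : gal_of {:L},
    {in integral, forall x, t (value x) = value (s x)} &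
  forall t : gal_of {:L}, exists2 s, s \in D &
    {in integral, forall x, t (value x) = value (s x)}].
Proof.
have [f fP] : exists f : gal_of {:L} -> gal_of {:N}, forall t,
    f t \in G /\ {in integral, forall x, t (value x) = value (f t x)}.
  pose P (t : gal_of {:L}) (s : gal_of {:N}) :=
    s \in G /\ {in integral, forall x, t (value x) = value (s x)}.
  have [t|f fP] := @choice _ _ P; last by exists f.
  by have [s] := gal_lift t; exists s.
have fM : {in H &, {morph f : t u / (t * u)%g}}.
  move=> t u _ _; apply: (gal_eq_on ys_gen) => y ys_y.
  have Iy := ys_int ys_y.
  apply: ys_inj; rewrite ?ys_gal // galM ?memvf //.
  have [_ <- //] := fP (t * u)%g; rewrite galM ?memvf //.
  by have [_ -> //] := fP t; have [_ -> //] := fP u; rewrite integral_gal.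
pose m := Morphism fM.
have inj_m : ('injm m)%g.
  apply/injmP=> t u _ _ /= eq_tu; apply: (gal_eq_on L_gen) => _ /mapP[y ys_y ->].
  have Iy := ys_int ys_y; have [_ -> //] := fP t; have [_ -> //] := fP u.
  by rewrite eq_tu.
exists (m @* H)%g%G; split.
- by apply/subsetP=> s _; apply: gal_inG.
- exact: sub_isog.
- by move=> s /morphimP[t _ _ ->]; exists t => x Ix; have [_ ->] := fP t.
move=> t; exists (f t); last by have [] := fP t.
by rewrite (mem_morphim m) // gal_kHom ?sub1v // k1HomE ahomWin.
Qed.
End Decomposition.

(** * Places of N above a rational point *)

Section Specialization.
Variables (N : splittingFieldType QT) (L : splittingFieldType rat) (t : rat).

Definition toQT : {rmorphism {poly rat} -> QT} := @tofrac {poly rat}.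

Definition spec_pair (a : {poly rat}) : (N * L)%type :=
  ((tofrac a)%:A, (a.[t])%:A).

Lemma spec_pair_zmod : zmod_morphism spec_pair.
Proof. by move=> a b; rewrite /spec_pair tofracB hornerD hornerN !scalerBl. Qed.

Lemma spec_pair_monoid : monoid_morphism spec_pair.
Proof.
split=> [|a b]; first by rewrite /spec_pair tofrac1 hornerC !scale1r.
by rewrite /spec_pair tofracM hornerM -!in_algE !rmorphM.
Qed.

HB.instance Definition _ := GRing.isZmodMorphism.Build _ _ spec_pair spec_pair_zmod.
HB.instance Definition _ := GRing.isMonoidMorphism.Build _ _ spec_pair spec_pair_monoid.

Lemma map_spec1 (P : ratXT) :
  map_poly (fst \o spec_pair) P = map_poly (in_alg N) (over_QT P).
Proof. by rewrite /over_QT -map_poly_comp; apply: eq_map_poly. Qed.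

Lemma map_spec2 (P : ratXT) :
  map_poly (snd \o spec_pair) P = map_poly (in_alg L) (specialize t P).
Proof. by rewrite /specialize -map_poly_comp; apply: eq_map_poly. Qed.

Lemma base_place : exists S : place N L, forall a, spec_pair a \in S.
Proof.
pose SM := GRing.isSubringClosed.Build {poly rat} predT
  (And3 isT (fun _ _ _ _ => isT) (fun _ _ _ _ => isT)).
pose R0 : subringClosed {poly rat} := HB.pack (predT : {pred {poly rat}}) SM.
have [a _|S SP] := @place_of_fractions N L _ R0 spec_pair; last first.
  by exists S => a; apply: SP.
move=> /eqP; rewrite /= alg_eq0 tofrac_eq0 => /eqP->.
by rewrite /= horner0 scale0r.
Qed.

(** The polynomial P can be made monic over the base place, where its leading
    coefficient is invertible; so its roots can be added to the domain. *)
Lemma place_with_roots (P : ratXT) (rs : seq N) (zs : seq L) :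
    (lead_coef P).[t] != 0 ->
    {in rs, forall z, root (map_poly (in_alg N) (over_QT P)) z} ->
    map_poly (in_alg L) (specialize t P) %= \prod_(z <- zs) ('X - z%:P) ->
  exists S : place N L, (forall a, spec_pair a \in S) /\ {subset rs <= regular S}.
Proof.
move=> lt0 P_rs P_zs; have [S0 S0P] := base_place.
have l2 : (spec_pair (lead_coef P)).2 != 0 by rewrite /= alg_eq0.
have [u Su ul] := place_inv (S0P _) l2.
have u2 : u.2 != 0.
  apply: contra_neq (oner_neq0 L) => u0.
  by rewrite -[1]/(1 : N * L).2 -ul /= u0 mul0r.
have l0 : spec_pair (lead_coef P) != 0 by apply: contra_neq l2 => ->.
pose g := u%:P * map_poly spec_pair P.
have mon_g : g \is monic.
  rewrite monicE /lead_coef /g mul_polyC.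
  have sg : size (u *: map_poly spec_pair P) = size P.
    apply/eqP; rewrite eqn_leq.
    rewrite (leq_trans (size_scale_leq _ _)) ?size_map_poly_id0 //=.
    have P0 : (0 < size P)%N.
      rewrite size_poly_gt0 -lead_coef_eq0.
      by apply: contra_neq l0 => ->; rewrite rmorph0.
    rewrite -[X in (X <= _)%N](ltn_predK P0) ltnNge.
    apply/negP => /leq_sizeP/(_ _ (leqnn _)).
    by rewrite coefZ coef_map /= ul => /eqP; rewrite oner_eq0.
  by rewrite sg coefZ coef_map /= ul.
have Sg : g \is a polyOver S0.
  by rewrite rpredM ?polyOverC //; apply/polyOverP => i; rewrite coef_map; apply: S0P.
have [z|//|S [S0S rsS]] := @place_extension_seq _ _ S0 g zs rs Sg mon_g.
- rewrite rmorphM /= map_polyC -map_poly_comp map_spec1 rootM => /P_rs->.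
  by rewrite orbT.
- rewrite rmorphM /= map_polyC -map_poly_comp map_spec2 mul_polyC.
  by rewrite (eqp_ltrans (eqp_scale _ u2)).
by exists S; split=> // a; apply: S0S.
Qed.

Section Place.
Variable S : place N L.
Hypothesis S_base : forall a, spec_pair a \in S.

(** A fraction c = a / b in lowest terms that is integral over Q[T] has no pole
    at t: if b vanished at t, the relation a - b X on c would have the nonzero
    constant a(t) as its value, against [integral_relation_proper]. *)
Lemma base_value (c : QT) : integralOver toQT c ->
  exists q : rat, (c%:A, q%:A) \in S.
Proof.
move=> [p mon_p pc]; have [a0 [b0 [nz_b0 Dc0]]] := fraction_quotient c.
have [a [b [co_ab b_neq0 Dc]]] :
    exists a b, [/\ coprimep a b, b != 0 & c * tofrac b = tofrac a].
  exists (a0 %/ gcdp a0 b0), (b0 %/ gcdp a0 b0).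
  have g0 : gcdp a0 b0 != 0 by rewrite gcdp_eq0 negb_and nz_b0 orbT.
  split; first by rewrite coprimep_div_gcd ?nz_b0 ?orbT.
    by rewrite dvdp_div_eq0 ?dvdp_gcdr.
  apply: (mulIf (_ : tofrac (gcdp a0 b0) != 0)); first by rewrite tofrac_eq0.
  by rewrite -mulrA -!tofracM !divpK ?dvdp_gcdl ?dvdp_gcdr.
have bt : b.[t] != 0.
  apply/negP => bt0.
  have at0 : a.[t] != 0 by apply: (coprimep_root _ bt0); rewrite coprimep_sym.
  suff /eqP : (a.[t])%:A = 0 :> L by rewrite /= alg_eq0 (negPf at0).
  pose q := (spec_pair a)%:P - (spec_pair b)%:P * 'X.
  have Sq : q \is a polyOver S by rewrite rpredB ?rpredM ?polyOverC ?polyOverX.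
  have Sg : map_poly spec_pair p \is a polyOver S.
    by apply/polyOverP=> i; rewrite coef_map; apply: S_base.
  apply: (integral_relation_proper (a := c%:A) Sq Sg).
  - exact: monic_map.
  - rewrite rmorphB rmorphM /= !map_polyC map_polyX /= rootE !hornerE.
    by rewrite -scalerAl mul1r scalerA mulrC Dc subrr.
  - rewrite -map_poly_comp map_spec1 fmorph_root; exact: pc.
  rewrite rmorphB rmorphM /= !map_polyC map_polyX /= (eqP bt0).
  by rewrite scale0r polyC0 mul0r subr0.
exists (a.[t] / b.[t]).
have [|z Sz zb] := @place_inv _ _ S (spec_pair b) (S_base b).
  by rewrite /= alg_eq0.
suff -> : (c%:A, (a.[t] / b.[t])%:A) = z * spec_pair a.
  by apply: rpredM => //; apply: S_base.
have := congr1 (fun w => w * (c%:A, (a.[t] / b.[t])%:A)) zb; rewrite mul1r => <-.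
rewrite -mulrA; congr (_ * _); apply/eqP; rewrite -pair_eqE /pair_eq /=.
rewrite -Dc -!scalerAl !mul1r !scalerA [_ * c]mulrC eqxx /=.
by rewrite mulrC divfK.
Qed.

Lemma root_value (Q : ratXT) b : b \in regular S ->
    root (map_poly (in_alg N) (over_QT Q)) b ->
  root (map_poly (in_alg L) (specialize t Q)) (value S b).
Proof.
move=> Sb; have SQ : map_poly spec_pair Q \is a polyOver S.
  by apply/polyOverP=> i; rewrite coef_map; apply: S_base.
rewrite -map_spec1 -map_spec2 !map_poly_comp -(map_value_fst SQ) !rootE => /eqP Qb.
rewrite -value_horner ?Qb ?value0 //.
by apply/polyOverP=> i; rewrite !coef_map /=; apply: (proj1 (valueP (S_base _))).
Qed.

Lemma split_value (Q : ratXT) (s : seq N) : {subset s <= regular S} ->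
    map_poly (in_alg N) (over_QT Q) %= \prod_(z <- s) ('X - z%:P) ->
  map_poly (in_alg L) (specialize t Q)
    = ((lead_coef Q).[t])%:A *: \prod_(z <- s) ('X - (value S z)%:P).
Proof.
move=> Ss /eqpfP; rewrite (monicP (monic_prod_XsubC _ _ _)) divr1.
set pN := map_poly (in_alg N) _ => DQ.
have lN : lead_coef pN = (tofrac (lead_coef Q))%:A.
  by rewrite lead_coef_map lead_coef_map_inj // ; apply: tofrac_inj.
have SQ : map_poly spec_pair Q \is a polyOver S.
  by apply/polyOverP=> i; rewrite coef_map; apply: S_base.
have [Rl <-] := valueP (S_base (lead_coef Q)).
rewrite -map_spec2 map_poly_comp -(map_value_fst SQ) -map_poly_comp map_spec1 -/pN.
rewrite DQ lN map_valueZ //.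
  by rewrite big_seq map_value_prod_XsubC // -big_seq.
rewrite big_seq rpred_prod // => z s_z.
by rewrite rpredB ?polyOverX ?polyOverC ?Ss.
Qed.
End Place.
End Specialization.

(** * Galois group of the specialized polynomial *)

Section Main.
Variables (N : splittingFieldType QT) (L : splittingFieldType rat) (t : rat).
Local Notation G := (Galois_group N).
Local Notation H := (Galois_group L).
Local Notation polyN Q := (map_poly (in_alg N) (over_QT Q)).
Local Notation polyL Q := (map_poly (in_alg L) (specialize t Q)).
Local Notation integral := (@integral QT N {poly rat} toQT).

Lemma monic_root_integral Q z : Q \is monic -> root (polyN Q) z -> z \in integral.
Proof.
move=> mon_Q Qz; apply/integralP; exists Q => //.
by rewrite map_poly_comp.
Qed.

Lemma scaled_root_integral Q z : root (polyN Q) z ->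
  tofrac (lead_coef Q) *: z \in integral.
Proof.
move=> Qz; apply/integralP; rewrite -mulr_algl.
by apply: (@integral_lead_mul _ _ (in_alg N \o toQT)); rewrite map_poly_comp.
Qed.

Lemma value_uniq (S : place N L) Q s : (forall a, spec_pair N L t a \in S) ->
    separable_poly (specialize t Q) -> (lead_coef Q).[t] != 0 ->
    {subset s <= regular S} -> polyN Q %= \prod_(z <- s) ('X - z%:P) ->
  uniq (map (value S) s).
Proof.
move=> S_base sepQ lt0 Ss /(split_value S_base Ss) DQ.
rewrite -separable_prod_XsubC big_map.
have e : polyL Q %= \prod_(z <- s) ('X - (value S z)%:P).
  by rewrite DQ eqp_scale ?alg_eq0.
by rewrite -(eqp_separable e) separable_map.
Qed.

Section Decomposition.
Variable P : ratXT.
Hypothesis P_lead : (lead_coef P).[t] != 0.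
Hypothesis P_sep : separable_poly (specialize t P).
Hypothesis N_split : is_splitting_field (over_QT P) N.
Hypothesis L_split : is_splitting_field (specialize t P) L.

(** The roots of P become integral over Q[T] when multiplied by the leading
    coefficient of P.  The scaled roots still generate N and have distinct
    values, and these values generate L. *)
Lemma specialized_decomposition :
  exists (S : place N L) (D : {group gal_of {:N}}),
  [/\ forall a, spec_pair N L t a \in S, {subset integral <= regular S},
      D \subset G /\ H \isog D,
      forall s, s \in D -> exists u : gal_of {:L},
        {in integral, forall x, u (value S x) = value S (s x)} &
      forall u : gal_of {:L}, exists2 s, s \in D &
        {in integral, forall x, u (value S x) = value S (s x)}].
Proof.
have [rs DP gen_rs] := N_split; have [zs DPt gen_zs] := L_split.
have root_rs z : (z \in rs) = root (polyN P) z.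
  by rewrite (eqp_root DP) root_prod_XsubC.
have P_rs z : z \in rs -> root (polyN P) z by rewrite root_rs.
have [S [S_base rs_reg]] := place_with_roots P_lead P_rs DPt.
have uniq_v := value_uniq S_base P_sep P_lead rs_reg DP.
pose l := lead_coef P; have lt0 : l.[t] != 0 := P_lead.
have l0 : tofrac l != 0.
  by rewrite tofrac_eq0; apply: contra_neq lt0 => ->; rewrite horner0.
have [Sl vl] := valueP (S_base l).
have vlz z : z \in rs -> value S (tofrac l *: z) = l.[t] *: value S z.
  move=> rs_z; rewrite -[in LHS]mulr_algl.
  by rewrite (valueM Sl (rs_reg _ rs_z)) vl mulr_algl.
pose ys := [seq tofrac l *: z | z <- rs].
have galN : galois 1 {:N} by apply/galois_char0/QT_char0.
have charL : has_char0 L by move=> p; rewrite pchar_lalg Num.Theory.pchar_num.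
have base c : integralOver toQT c -> exists q : rat, (c%:A, q%:A) \in S.
  exact: (base_value S_base (c := c)).
have ys_int : {subset ys <= integral}.
  by move=> _ /mapP[z rs_z ->]; apply: scaled_root_integral; rewrite -root_rs.
have ys_reg : {subset ys <= regular S}.
  by move=> _ /mapP[z rs_z ->]; rewrite -mulr_algl (rpredM Sl (rs_reg _ rs_z)).
have ys_gen : <<1 & ys>>%VS = fullv.
  apply/eqP; rewrite eqEsubv subvf /= -gen_rs; apply/Fadjoin_seqP; split=> [|z rs_z].
    exact: subv_adjoin_seq.
  rewrite -[z](scalerK l0) memvZ // seqv_sub_adjoin //.
  by apply: map_f.
have ys_gal (s : gal_of {:N}) y : y \in ys -> s y \in ys.
  case/mapP=> z rs_z ->; rewrite linearZ /=; apply: map_f.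
  by rewrite root_rs alg_root_gal // -root_rs.
have ys_inj : {in ys &, injective (value S)}.
  move=> _ _ /mapP[z rs_z ->] /mapP[z' rs_z' ->]; rewrite !vlz // => /scalerI e.
  congr (_ *: _); have {}e := e lt0.
  exact: (uniq_map_inj uniq_v).
have L_gen : <<1 & map (value S) ys>>%VS = fullv.
  apply/eqP; rewrite eqEsubv subvf /= -gen_zs; apply/Fadjoin_seqP; split=> [|w].
    exact: subv_adjoin_seq.
  rewrite -root_prod_XsubC -(eqp_root DPt) (split_value S_base rs_reg DP).
  rewrite rootZ ?alg_eq0 // -(big_map (value S) xpredT (fun x => 'X - x%:P)).
  rewrite root_prod_XsubC => /mapP[z rs_z ->].
  rewrite -[value S z](scalerK lt0) memvZ // seqv_sub_adjoin // -vlz //.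
  by rewrite !map_f.
have [D [sDG iso D1 D2]] := decomposition_group galN charL base
  ys_int ys_reg ys_gen ys_gal ys_inj L_gen.
have reg := integral_regular galN charL base ys_int ys_reg ys_gen ys_gal ys_inj.
by exists S, D; split.
Qed.

(** Roots of P are quotients of integral elements by the leading coefficient of
    P, whose value l(t) is nonzero. *)
Lemma root_regular (S : place N L) z : (forall a, spec_pair N L t a \in S) ->
  {subset integral <= regular S} -> root (polyN P) z -> z \in regular S.
Proof.
move=> S_base reg Pz; have [Sl vl] := valueP (S_base (lead_coef P)).
apply: (regular_div _ Sl); last by rewrite vl alg_eq0.
by rewrite mulrC mulr_algl; apply: reg; apply: scaled_root_integral.
Qed.

Lemma gal_value_root (S : place N L) (s : gal_of {:N}) (u : gal_of {:L}) z :
    (forall a, spec_pair N L t a \in S) -> {subset integral <= regular S} ->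
    {in integral, forall x, u (value S x) = value S (s x)} ->
  root (polyN P) z -> u (value S z) = value S (s z).
Proof.
move=> S_base reg us Pz; have [Sl vl] := valueP (S_base (lead_coef P)).
have vlz y : root (polyN P) y ->
    value S (tofrac (lead_coef P) *: y) = (lead_coef P).[t] *: value S y.
  move=> /(root_regular S_base reg) Sy.
  by rewrite -[in LHS]mulr_algl (valueM Sl Sy) vl mulr_algl.
have := us _ (scaled_root_integral Pz).
rewrite linearZ /= !vlz ?alg_root_gal // linearZ /= => /scalerI; exact.
Qed.

Lemma isog_decomposition (D : {group gal_of {:N}}) :
  D \subset G -> H \isog D -> (H \isog G) = (D :==: G).
Proof.
move=> sDG isoD; apply/idP/eqP => [isoG|<- //].
by apply/eqP; rewrite eqEcard sDG -(card_isog isoD) (card_isog isoG) leqnn.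
Qed.

(** Here D is all of G, which permutes the roots of P transitively.  Any root of
    a factor q of P_t is thus moved to every other one by Gal(L/Q), which
    preserves the roots of q. *)
Lemma isog_irreducible : irreducible_poly (over_QT P) -> H \isog G ->
  irreducible_poly (specialize t P).
Proof.
have [S [D [S_base reg [sDG isoD] D1 _]]] := specialized_decomposition.
move=> irrP; rewrite (isog_decomposition sDG isoD) => /eqP DG.
have [rs DP _] := N_split.
have P_rs z : (z \in rs) = root (polyN P) z.
  by rewrite (eqp_root DP) root_prod_XsubC.
have rs_reg : {subset rs <= regular S}.
  by move=> z; rewrite P_rs; apply: root_regular.
have uniq_v := value_uniq S_base P_sep P_lead rs_reg DP.
have DPt : polyL P %= \prod_(w <- map (value S) rs) ('X - w%:P).
  by rewrite (split_value S_base rs_reg DP) big_map eqp_scale ?alg_eq0.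
split=> [|q sq dvd_q].
  rewrite size_map_poly_id0 //; case: irrP => [sP _].
  by rewrite size_map_inj_poly ?rmorph0 // in sP; exact: tofrac_inj.
rewrite /eqp dvd_q /= -(dvdp_map (in_alg L)) (eqp_dvdl _ DPt).
rewrite uniq_roots_dvdp ?uniq_rootsE //.
have [w rs_w qw] :
    exists2 w, w \in map (value S) rs & root (map_poly (in_alg L) q) w.
  have : map_poly (in_alg L) q %| \prod_(w <- map (value S) rs) ('X - w%:P).
    by rewrite -(eqp_dvdr _ DPt) dvdp_map.
  case/dvdp_prod_XsubC=> m; have := mem_mask (m := m) (s := map (value S) rs).
  case: (mask _ _) => [|w s] sub_m Dq.
    case/eqP: sq; rewrite -(size_map_poly (in_alg L)) (eqp_size Dq).
    by rewrite big_nil size_poly1.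
  exists w; first by apply: sub_m; rewrite mem_head.
  by rewrite (eqp_root Dq) big_cons rootM root_XsubC eqxx.
case/mapP: rs_w qw => z0 rs_z0 -> qz0.
apply/allP=> _ /mapP[z rs_z ->].
have [|s Gs <-] := @normalField_root_minPoly _ _ 1%AS {:N}%AS z0 z
  (sub1v _) (normalFieldf _) (memvf _).
  by rewrite -(eqp_root (irreducible_root_minPoly irrP _)) -P_rs.
have [u us] := D1 s (eq_ind_r (fun A : {set _} => s \in A) Gs DG).
by rewrite -(gal_value_root S_base reg us) -?P_rs // alg_root_gal.
Qed.

Section Resolvent.
Variables (M : {group gal_of {:N}}) (Q : ratXT).
Hypothesis Q_monic : Q \is monic.
Hypothesis Q_gen : generated_by_root Q (fixedField M).

(** If a is the generator of the fixed field of M, the root x a of Q is fixed by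
    M :^ x, hence by D; its value is then fixed by Gal(L/Q), that is,
    rational. *)
Lemma sub_conj_root (S : place N L) (D : {group gal_of {:N}}) x :
    (forall a, spec_pair N L t a \in S) -> {subset integral <= regular S} ->
    (forall u : gal_of {:L}, exists2 s, s \in D &
        {in integral, forall x, u (value S x) = value S (s x)}) ->
    D \subset (M :^ x)%g ->
  exists c : rat, root (specialize t Q) c.
Proof.
move=> S_base reg D2 /subsetP sDM; have [a Qa gen_a] := Q_gen.
have /mem_fixedFieldP[_ fix_a] : a \in fixedField M by rewrite -gen_a memv_adjoin.
have Qb : root (polyN Q) (x a) by apply: alg_root_gal.
have Ib := monic_root_integral Q_monic Qb.
have : value S (x a) \in 1%VS.
  have /galois_fixedField <- : galois 1 {:L}.
    by apply: galois_char0 => p; rewrite Num.Theory.pchar_num.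
  apply/fixedFieldP=> [|u _]; first exact: memvf.
  have [s /sDM] := D2 u; rewrite mem_conjg => Ms ->//.
  by rewrite -galM ?memvf // conjgCV galM ?memvf // fix_a.
case/vlineP=> c Dc; exists c; rewrite -(fmorph_root (in_alg L)) /= -Dc.
by apply: root_value => //; apply: reg.
Qed.

Hypothesis Q_irr : irreducible_poly (over_QT Q).
Hypothesis Q_sep : separable_poly (specialize t Q).

(** The root c is the value of a root z of Q in N, and each s in D = G maps z to
    a root with the same value, hence to z itself because Q_t is separable.  So z
    is in Q(T), as is the conjugate a of z that generates the fixed field of
    M. *)
Lemma isog_root_fixedField c : H \isog G -> root (specialize t Q) c -> M :=: G.
Proof.
have [S [D [S_base reg [sDG isoD] D1 _]]] := specialized_decomposition.
rewrite (isog_decomposition sDG isoD) => /eqP DG Qc.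
have [a Qa gen_a] := Q_gen.
have galN : galois 1 {:N} by apply/galois_char0/QT_char0.
have [r _ Dr] := normalField_factors (sub1v _) (normalFieldf 1) a (memvf a).
have DQ : polyN Q %= \prod_(z <- [seq s a | s : gal_of {:N} <- r]) ('X - z%:P).
  by rewrite big_map -Dr irreducible_root_minPoly.
set rs := map _ _ in DQ.
have Q_rs z : (z \in rs) = root (polyN Q) z.
  by rewrite (eqp_root DQ) root_prod_XsubC.
have rs_reg : {subset rs <= regular S}.
  by move=> z; rewrite Q_rs => /(monic_root_integral Q_monic)/reg.
have lt0 : (lead_coef Q).[t] != 0 by rewrite (monicP Q_monic) hornerC oner_eq0.
have v_inj := uniq_map_inj (value_uniq S_base Q_sep lt0 rs_reg DQ).
have : root (polyL Q) c%:A by rewrite fmorph_root.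
rewrite (split_value S_base rs_reg DQ) rootZ ?alg_eq0 //.
rewrite -(big_map (value S) xpredT (fun x => 'X - x%:P)) root_prod_XsubC.
case/mapP=> z rs_z Dc.
have : z \in 1%VS.
  rewrite -(galois_fixedField galN); apply/fixedFieldP=> [|s Gs]; first exact: memvf.
  have [u us] := D1 s (eq_ind_r (fun A : {set _} => s \in A) Gs DG).
  apply: v_inj => //; first by rewrite Q_rs alg_root_gal -?Q_rs.
  have Iz : z \in integral by apply: (monic_root_integral Q_monic); rewrite -Q_rs.
  by rewrite -us // -Dc rmorph_alg.
case/vlineP=> d Dz; case/mapP: rs_z => s _.
rewrite Dz -(rmorph_alg s) => /fmorph_inj Da.
rewrite -(gal_fixedField M) -gen_a.
suff /Fadjoin_idP-> : a \in 1%VS by [].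
by apply/vlineP; exists d.
Qed.
End Resolvent.
End Decomposition.
End Main.

Lemma irreducible_monic_size (Q : ratXT) :
  irreducible_elt Q -> Q \is monic -> (1 < size Q)%N.
Proof.
move=> [unitQ _] mon_Q; rewrite ltnNge; apply: contra unitQ => sQ.
by move: mon_Q; rewrite (size1_polyC sQ) monicE lead_coefC => /eqP->; rewrite rpred1.
Qed.

Theorem theorem1p1
  (P : ratXT) (P_irr : irreducible_elt P) (P_deg : (1 < size P)%N)
  (N : splittingFieldType QT) (N_split : is_splitting_field (over_QT P) N)
  (r : nat) (M : 'I_r -> {group gal_of {:N}})
  (M_reps : maximal_class_reps (Galois_group N) M)
  (f : 'I_r -> ratXT)
  (f_monic : forall i, f i \is monic)
  (f_irr : forall i, irreducible_elt (f i))
  (f_gen : forall i, generated_by_root (f i) (fixedField (M i)))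
  (t : rat)
  (t_good : (disc_X P).[t] * (lead_coef P).[t] *
            \prod_(i < r) disc (specialize t (f i)) != 0) :
  exceptional P N t <->
  exists (i : 'I_r) (x : rat), root (specialize t (f i)) x.
Proof.
move: t_good; rewrite mulf_eq0 negb_or => /andP[P_good /prodf_neq0 f_good].
have P_sep := specialize_separable P_deg P_good.
have P_lead : (lead_coef P).[t] != 0.
  by move: P_good; rewrite mulf_eq0 negb_or => /andP[].
have f_over i := irreducible_over_QT (f_irr i)
  (irreducible_monic_size (f_irr i) (f_monic i)).
have P_over := irreducible_over_QT P_irr P_deg.
have isogPn (L : splittingFieldType rat) :
    is_splitting_field (specialize t P) L ->
    ~ (Galois_group L \isog Galois_group N) <->
    exists (i : 'I_r) (x : rat), root (specialize t (f i)) x.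
  move=> L_split; split=> [not_iso|[i [c fc]] iso].
    have [S [D [S_base reg [sDG isoD] _ D2]]] :=
      specialized_decomposition P_lead P_sep N_split L_split.
    have [DG|[M0 maxM0 sDM0]] := maximal_exists sDG.
      by case: not_iso; rewrite -DG.
    have [i [[x _ DM0] _]] := M_reps.2 M0 maxM0; exists i.
    apply: (sub_conj_root (f_monic i) (f_gen i) S_base reg D2 (x := x)).
    by rewrite -DM0.
  have sepf : separable_poly (specialize t (f i)).
    exact/disc_separable/f_good.
  have MG := isog_root_fixedField P_lead P_sep N_split L_split
    (f_monic i) (f_gen i) (f_over i) sepf iso fc.
  by have /maxgroupp := M_reps.1 i; rewrite MG properxx.
have Pt0 : specialize t P != 0.
  by rewrite map_poly_eq0_id0 // -size_poly_gt0 ltnW.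
have [L0 L0_split] := exists_splitting_field Pt0.
split=> [[red|[L L_split]]|roots].
- apply/(isogPn L0 L0_split) => iso; apply: red.
  exact: isog_irreducible iso.
- by move/isogPn; apply.
- by right; exists L0 => //; apply/isogPn.
Qed.
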